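(* Let $S$ and $S'$ be two graphs, each on the same number $n\ge 2$ of vertices and each satisfying the hypotheses described in the context, with $|\Pi_1(S)|=|\Pi_1(S')|$. Then the flipping groups $\mathbf W(S)$ and $\mathbf W(S')$ are isomorphic. That is, the flipping group is unique up to isomorphism among such graphs with a given value of $|\Pi_1|$.
   Context: A graph $S$ satisfies the hypotheses if it is a finite simple connected graph with vertex set $\{s_1,\dots,s_n\}$ and edge set $R$ such that $s_1,\dots,s_{n-1}$ is an induced path. The neighbours of $s_n$ are some $s_{j_1},\dots,s_{j_m}$ with $1\le j_1<\dots<j_m\le n-1$. $\widetilde s$ is the characteristic vector in $F_2^n$ (coordinates indexed by vertices) of vertex $s$. The flipping move of $s$ is $\mathbf s\in\mathrm{Mat}_n(F_2)$ with $\mathbf s_{ab}=1$ if $a=b$, or if $b=s$ and $ab\in R$, and $0$ otherwise. The flipping group $\mathbf W(S)$ is the subgroup of $\mathrm{GL}_n(F_2)$ generated by $\mathbf{s_1},\dots,\mathbf{s_n}$. $\overline1=\widetilde s_1$ and $\overline{i+1}=\mathbf{s_i}\cdots\mathbf{s_1}\overline1$ for $1\le i\le n-1$. $\Pi=\{\overline1,\dots,\overline n\}$, $\Pi_0=\{\overline i\in\Pi:\langle\overline i,\widetilde s_n\rangle=0\}$ (dot product over $F_2$), and $\Pi_1(S)=\Pi\setminus\Pi_0$. *)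

(* Defs.v *)
From HB Require Import structures.
From mathcomp Require Import all_boot all_order all_algebra all_fingroup.

Set Implicit Arguments.
Unset Strict Implicit.
Unset Printing Implicit Defensive.

Import GRing.Theory.
Local Open Scope ring_scope.

Record sgraph (V : finType) := SGraph {
  adj :> rel V;
  adj_sym : symmetric adj;
  adj_irr : irreflexive adj
}.

(* A graph on the N = n.+1 vertices s_1, ..., s_N is encoded on 'I_n.+1:
   the ordinal i stands for s_(i+1), so ord0 is s_1, ord_max is s_N, and the
   ordinals i < n are the vertices s_1, ..., s_(N-1). *)
Section FlippingGroup.

Variables (n : nat) (S : sgraph 'I_n.+1).

Definition is_connected : Prop := forall x y, connect S x y.

Definition induced_path : Prop :=
  forall i j : 'I_n.+1, (i < n)%N -> (j < n)%N ->
    S i j = (i.+1 == j :> nat) || (j.+1 == i :> nat).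

Definition satisfies_hypotheses : Prop := is_connected /\ induced_path.

Definition char_vec (s : 'I_n.+1) : 'cV['F_2]_n.+1 := delta_mx s 0.

Definition flip_mx (s : 'I_n.+1) : 'M['F_2]_n.+1 :=
  \matrix_(a, b) ((a == b) || (b == s) && S a b)%:R.

Lemma flip_mxK (s : 'I_n.+1) : flip_mx s *m flip_mx s = 1%:M.
Proof.
apply/matrixP=> a b; rewrite !mxE (bigD1 a) //= !mxE eqxx mul1r.
have [->|nab] := eqVneq a b.
  rewrite big1 ?addr0 // => c nca; rewrite !mxE eq_sym (negPf nca) /=.
  have [->|] := eqVneq c s; last by rewrite mul0r.
  by have [->|_] := eqVneq b s; rewrite ?adj_irr ?mulr0 ?mul0r //= mulr0.
rewrite (bigD1 b) /=; last by rewrite eq_sym.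
rewrite !mxE eqxx (negPf nab) mulr1 /= big1 ?addr0.
  by case: (_ && _); apply/eqP.
move=> c /andP[nca ncb]; rewrite !mxE eq_sym (negPf nca) (negPf ncb) /=.
have [->|] := eqVneq c s; last by rewrite mul0r.
by have [->|_] := eqVneq b s; rewrite ?adj_irr mulr0.
Qed.

Lemma flip_mx_unit (s : 'I_n.+1) : flip_mx s \is a GRing.unit.
Proof. by apply/unitrP; exists (flip_mx s); split; apply: flip_mxK. Qed.

Definition flip (s : 'I_n.+1) : {'GL_n.+1['F_2]} :=
  FinRing.unit _ (flip_mx_unit s).

Definition flipping_group : {group {'GL_n.+1['F_2]}} :=
  <<[set flip s | s : 'I_n.+1]>>%G.

(* With the same shift, bar i is the vector written \overline{i+1}. *)
Fixpoint bar (i : nat) : 'cV['F_2]_n.+1 :=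
  if i is j.+1 then flip_mx (inord j) *m bar j else char_vec ord0.

Definition dot (u v : 'cV['F_2]_n.+1) : 'F_2 := \sum_a u a 0 * v a 0.

Definition Pi : {set 'cV['F_2]_n.+1} := [set bar i | i : 'I_n.+1].

Definition Pi0 : {set 'cV['F_2]_n.+1} :=
  [set u in Pi | dot u (char_vec ord_max) == 0].

Definition Pi1 : {set 'cV['F_2]_n.+1} := Pi :\: Pi0.

End FlippingGroup.

(* Main.v *)
(* Let N = n.+1.  The vectors bar 1, ..., bar N and e_N (the characteristic
   vector of s_N) span F_2^N, and the only relation between them is
   bar 1 + ... + bar N = |Pi1| e_N.  For i < N the move s_i exchanges bar i and
   bar (i+1) and fixes the other spanning vectors, so the flipping group realizes
   every permutation of the bars.  The move s_N fixes Pi0 pointwise and adds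
   to e_N and to each element of Pi1 the same vector, namely the sum of Pi1
   plus |Pi1| e_N.  Given S' with |Pi1 S'| = |Pi1 S|, a bijection of the bars
   matching Pi1 S with Pi1 S' therefore extends to a linear isomorphism fixing
   e_N, and it conjugates one flipping group into the other. *)
Require Import Defs.
From mathcomp Require Import all_boot all_order all_algebra all_fingroup.

Set Implicit Arguments.
Unset Strict Implicit.
Unset Printing Implicit Defensive.

Import GRing.Theory.
Local Open Scope ring_scope.

(** * Scalars in ['F_2] and permutations of ordinals *)

Lemma natrF2_addb (b c : bool) : (b (+) c)%:R = b%:R + c%:R :> 'F_2.
Proof. by apply/val_inj; case: b; case: c. Qed.

Lemma addF2_self (m p : nat) (A : 'M['F_2]_(m, p)) : A + A = 0.
Proof.
apply/matrixP=> i j; rewrite !mxE -mulr2n -mulr_natr.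
by rewrite (_ : 2%:R = 0 :> 'F_2) ?mulr0 //; apply/val_inj.
Qed.

(** The transpositions of [ord0] with a varying point generate the symmetric group, and each arises
    from the previous one by conjugation with an adjacent transposition. *)
Lemma gen_tperm_adjacent (n : nat) (G : {group 'S_n.+1}) :
  (forall i : 'I_n.+1, (i < n)%N -> tperm i (inord i.+1) \in G) ->
  forall s, s \in G.
Proof.
move=> adjG s.
suff tG (i : nat) : (i < n.+1)%N -> tperm ord0 (inord i) \in G.
  have: s \in [set: 'S_n.+1] by rewrite inE.
  rewrite -(gen_tperm ord0); apply/subsetP; rewrite gen_subG.
  by apply/subsetP=> _ /imsetP[j _ ->]; rewrite -(inord_val j) tG.
elim: i => [|i IHi] ltin.
  by rewrite (_ : inord 0 = ord0) ?tperm1 //; apply/val_inj; rewrite /= inordK.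
have lti: (i < n.+1)%N := ltnW ltin.
case: i => [|i] in IHi lti ltin *.
  rewrite (_ : ord0 = inord 0); last by apply/val_inj; rewrite /= inordK.
  by have:= adjG (inord 0); rewrite inordK //; apply.
have ne (k l : nat) : (k < n.+1)%N -> (l < n.+1)%N -> k != l ->
    inord k != inord l :> 'I_n.+1.
  by move=> ltk ltl; apply: contra => /eqP/(congr1 val); rewrite /= !inordK // => ->.
rewrite -(@tpermJ_tperm _ (inord i.+1)).
- rewrite tpermC groupJ 1?tpermC ?IHi //.
  by have:= adjG (inord i.+1); rewrite inordK //; apply.
- by rewrite ne // neq_ltn ltnSn.
- by apply/eqP=> /(congr1 val); rewrite /= inordK.
Qed.

(** The boolean tuples of values of [P] and [Q] contain equally many [true], so one is a
    rearrangement of the other. *)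
Lemma card_eq_perm (n : nat) (P Q : pred 'I_n) :
  #|P| = #|Q| -> exists s : 'S_n, forall x, Q (s x) = P x.
Proof.
move=> eqPQ.
have sizeE (R : pred 'I_n) : count id [tuple R x | x < n] = #|R|.
  by rewrite /= count_map cardE -size_filter enumT.
have countE (a : pred bool) (t : seq bool) :
    count a t = (a true * count id t + a false * (size t - count id t))%N.
  rewrite -(count_predC id t) addKn.
  elim: t => [|b t IHt] /=; first by rewrite !muln0.
  by rewrite IHt; case: b; rewrite /= add0n add1n mulnS;
    [rewrite addnA | rewrite addnCA].
have /tuple_permP[s eqs] : perm_eq [tuple P x | x < n] [tuple Q x | x < n].
  by apply/seq.permP=> a; rewrite 2!(countE a) !size_tuple !sizeE eqPQ.
exists s => x; have /(congr1 (fun t => tnth t x)) := val_inj eqs.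
by rewrite !tnth_mktuple => <-.
Qed.

(** * Coordinates of the bar vectors and their linear relations *)

Section Flipping.

Variables (n : nat) (S : sgraph 'I_n.+1).

Local Notation top := (char_vec (ord_max : 'I_n.+1)).

(** Parity of the number of neighbours of [ord_max] among the first [i] path vertices. It is the
    last coordinate of [bar S i], hence decides membership in [Pi1]. *)
Fixpoint nbr_parity (i : nat) : bool :=
  if i is j.+1 then nbr_parity j (+) S (inord j) ord_max else false.

Definition nbr_vec (s : 'I_n.+1) : 'cV['F_2]_n.+1 := \col_a (S a s)%:R.

Lemma flip_mulE (s : 'I_n.+1) (v : 'cV['F_2]_n.+1) :
  flip_mx S s *m v = v + v s 0 *: nbr_vec s.
Proof.
apply/colP=> a; rewrite !mxE (bigD1 a) //= !mxE eqxx mul1r; congr (_ + _).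
have [->|nas] := eqVneq a s.
  rewrite adj_irr mulr0 big1 // => b nbs; rewrite !mxE eq_sym (negPf nbs) /=.
  by rewrite mul0r.
rewrite (bigD1 s) 1?eq_sym //= !mxE (negPf nas) eqxx /= mulrC big1 ?addr0 //.
by move=> b /andP[nba nbs]; rewrite !mxE eq_sym (negPf nba) (negPf nbs) mul0r.
Qed.

Lemma flip_top (s : 'I_n.+1) :
  flip_mx S s *m top = top + (s == ord_max)%:R *: nbr_vec s.
Proof. by rewrite flip_mulE !mxE eqxx andbT. Qed.

Hypotheses (n_gt0 : (0 < n)%N) (pathS : induced_path S).

(** On the path [bar S i] is e_(i-1) + e_i: move [i] adds e_(i-1) + e_(i+1), and e_(i-1) cancels.
    Only one term survives at each end, [i = 0] and [i = n]. *)
Lemma barE (i : nat) (a : 'I_n.+1) : (i <= n)%N ->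
  bar S i a 0 = if a == ord_max then (nbr_parity i)%:R
                else (a == i :> nat)%:R + (a.+1 == i :> nat)%:R.
Proof.
elim: i a => [|i IHi] a lei.
  rewrite !mxE /= andbT addr0 -!(inj_eq val_inj) /=.
  by case: (eqVneq (a : nat) n) => // ->; rewrite gtn_eqF.
have lti: (i < n.+1)%N := ltnW lei.
have ni: (inord i : 'I_n.+1) != ord_max.
  by rewrite -(inj_eq val_inj) /= inordK // ltn_eqF.
rewrite /= flip_mulE !mxE !IHi ?(ltnW lei) // (negPf ni) inordK // eqxx.
rewrite (gtn_eqF (ltnSn i)).
rewrite mulr0n mulr1n addr0 mul1r; case: eqVneq => [->|na].
  by rewrite natrF2_addb adj_sym.
have lta: (a < n)%N by rewrite ltn_neqAle -ltnS ltn_ord andbT.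
rewrite pathS ?inordK // eqSS -!natrF2_addb; congr (nat_of_bool _)%:R.
have [<-|_] := eqVneq a.+1 i; first by rewrite /= !ltn_eqF.
by rewrite addbF addbC [i.+1 == _]eq_sym.
Qed.

Lemma sum_scale_bar (f : nat -> 'F_2) (a : 'I_n.+1) :
  (\sum_(i < n.+1) f i *: bar S i) a 0 =
    if a == ord_max then \sum_(i < n.+1) f i * (nbr_parity i)%:R
    else f a + f a.+1.
Proof.
rewrite summxE; under eq_bigr => i _ do rewrite mxE barE -1?ltnS //.
have [//|na] := eqVneq a ord_max.
have sum1 (k : nat) : (k < n.+1)%N ->
    \sum_(i < n.+1) f i * (k == i :> nat)%:R = f k.
  move=> ltk; rewrite (bigD1 (Ordinal ltk)) //= eqxx mulr1 big1 ?addr0 // => i.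
  by rewrite -(inj_eq val_inj) /= eq_sym => /negPf->; rewrite mulr0.
under eq_bigr => i _ do rewrite mulrDr.
rewrite big_split /= !sum1 // ltnS ltn_neqAle -ltnS ltn_ord andbT.
by rewrite -(inj_eq val_inj) in na.
Qed.

(** Each path coordinate occurs in exactly two bars and so cancels. The scalar is the class of |Pi1|
    modulo 2. *)
Lemma sum_bar :
  \sum_(i < n.+1) bar S i = (\sum_(i < n.+1) (nbr_parity i)%:R) *: top.
Proof.
apply/colP=> a; under eq_bigr => i _ do rewrite -[bar S i]scale1r.
rewrite (sum_scale_bar (fun=> 1)) !mxE andbT; case: eqP => _.
  by rewrite mulr1; apply: eq_bigr => i _; rewrite mul1r.
by rewrite mulr0; apply/val_inj.
Qed.

(** The parities at [a] and [a.+1] differ exactly when [a] is adjacent to [ord_max]. The multiple of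
    [top] clears the last coordinate. *)
Lemma nbr_vec_last :
  nbr_vec ord_max = \sum_(i < n.+1) (nbr_parity i)%:R *: bar S i
    + (\sum_(i < n.+1) (nbr_parity i)%:R) *: top.
Proof.
apply/colP=> a; rewrite [RHS]mxE (sum_scale_bar (fun i => (nbr_parity i)%:R)) !mxE.
rewrite andbT; have [->|na] := eqVneq a ord_max.
  rewrite adj_irr mulr1 -big_split big1 // => i _.
  by case: (nbr_parity i); apply/val_inj.
by rewrite mulr0 addr0 -natrF2_addb /= inord_val addKb.
Qed.

(** The coefficients [i <= a] change only between [a] and [a.+1], so [a] is the one path coordinate
    left. *)
Lemma char_vec_bar (a : 'I_n.+1) : a != ord_max ->
  char_vec a = \sum_(i < n.+1 | (i <= a)%N) (bar S i + (nbr_parity i)%:R *: top).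
Proof.
have mkcond (F : 'I_n.+1 -> 'cV['F_2]_n.+1) :
    \sum_(i < n.+1 | (i <= a)%N) F i = \sum_(i < n.+1) (i <= a)%:R *: F i.
  rewrite big_mkcond; apply: eq_bigr => i _.
  by case: leqP; rewrite (scale1r, scale0r).
move=> na; apply/colP=> b; rewrite big_split /= !mkcond [RHS]mxE.
rewrite (sum_scale_bar (fun i => (i <= a)%:R)) summxE.
under [X in _ + X]eq_bigr => i _ do rewrite !mxE andbT.
rewrite !mxE andbT; have [->|nb] := eqVneq b ord_max.
  rewrite eq_sym (negPf na) -big_split big1 // => i _; rewrite mulr1.
  by case: (nbr_parity i); case: leqP => _; apply/val_inj.
rewrite big1 => [|i _]; last by rewrite !mulr0.
rewrite addr0 -natrF2_addb -(inj_eq val_inj) /=.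
by case: ltngtP.
Qed.

(** * Linear maps prescribed on the bars and on [top] *)

Lemma eq_mulmx_bar (M M' : 'M['F_2]_n.+1) :
  (forall i : 'I_n.+1, M *m bar S i = M' *m bar S i) ->
  M *m top = M' *m top -> M = M'.
Proof.
move=> eqbar eqtop; suff eqcol a : M *m char_vec a = M' *m char_vec a.
  apply/matrixP=> i a; have /colP/(_ i) := eqcol a.
  by rewrite /char_vec -!colE !mxE.
have [->//|na] := eqVneq a ord_max.
rewrite char_vec_bar // !mulmx_sumr; apply: eq_bigr => i _.
by rewrite !mulmxDr -!scalemxAr eqbar eqtop.
Qed.

(* The relation [sum_bar] is the only one among the bar vectors and the last
   unit vector. *)
Lemma exists_mulmx_bar (w : 'I_n.+1 -> 'cV['F_2]_n.+1) (u : 'cV['F_2]_n.+1) :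
  \sum_i w i = (\sum_(i < n.+1) (nbr_parity i)%:R) *: u ->
  exists M : 'M['F_2]_n.+1,
    (forall i : 'I_n.+1, M *m bar S i = w i) /\ M *m top = u.
Proof.
move=> sumw; pose F (i : 'I_n.+1) := w i + (nbr_parity i)%:R *: u.
(* By [char_vec_bar], the required map must send [char_vec a] to [U a.+1] for [a != ord_max]; this
   dictates the columns of [M]. *)
pose U k := \sum_(i < n.+1 | (i < k)%N) F i.
have U0 : U 0%N = 0 by rewrite /U big_pred0.
(* The assumed relation on [w] enters here. *)
have Un : U n.+1 = 0.
  rewrite /U (eq_bigl predT) => [|i]; last by rewrite ltn_ord.
  by rewrite big_split /= sumw scaler_suml addF2_self.
have US (i : 'I_n.+1) : U i.+1 = F i + U i.
  rewrite /U (bigD1 i) //=; congr (_ + _); apply: eq_bigl => j.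
  by rewrite ltnS -(inj_eq val_inj) andbC -ltn_neqAle.
pose M := \matrix_(a, b) (if b == ord_max then u else U b.+1) a 0 : 'M['F_2]_n.+1.
have ME x : M *m x = \sum_b x b 0 *: (if b == ord_max then u else U b.+1).
  by apply/colP=> a; rewrite !mxE summxE; apply: eq_bigr => b _; rewrite !mxE mulrC.
exists M; split=> [i|]; last first.
  rewrite ME (bigD1 ord_max) //= eqxx !mxE eqxx scale1r big1 ?addr0 // => b nb.
  by rewrite !mxE (negPf nb) scale0r.
have lei : (i <= n)%N by rewrite -ltnS.
rewrite ME (bigD1 ord_max) //= barE // eqxx.
(* Since [U n.+1 = 0], the index [ord_max] may join the sum, which then collapses to
   [U i.+1 + U i = F i]. *)
transitivity ((nbr_parity i)%:R *: u + \sum_(b < n.+1)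
    ((b == i :> nat)%:R *: U b.+1 + (b.+1 == i :> nat)%:R *: U b.+1)).
  rewrite [in RHS](bigD1 ord_max) //= Un !scaler0 !add0r; congr (_ + _).
  by apply: eq_bigr => b nb; rewrite barE // (negPf nb) scalerDl.
rewrite big_split /= (bigD1 i) //= eqxx scale1r big1 => [|b]; last first.
  by rewrite -(inj_eq val_inj) => /negPf->; rewrite scale0r.
have -> : \sum_(b < n.+1) (b.+1 == i :> nat)%:R *: U b.+1 = U i.
  case: (val i) lei => [|k] ltk.
    by rewrite U0 big1 // => b _; rewrite scale0r.
  rewrite (bigD1 (inord k)) //= inordK ?ltnS ?(ltnW ltk) // eqxx scale1r.
  rewrite big1 ?addr0 // => b.
  rewrite -(inj_eq val_inj) /= inordK ?ltnS ?(ltnW ltk) //.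
  by rewrite eqSS => /negPf->; rewrite scale0r.
by rewrite addr0 US /F -!addrA addF2_self addr0 addrCA addF2_self addr0.
Qed.

Lemma card_Pi1 : #|Pi1 S| = #|[pred i : 'I_n.+1 | nbr_parity i]|.
Proof.
have dotE (i : 'I_n.+1) : dot (bar S i) top = (nbr_parity i)%:R.
  rewrite /dot (bigD1 ord_max) //= !mxE eqxx mulr1 big1 => [|a na].
    by rewrite addr0 barE ?eqxx // -ltnS.
  by rewrite !mxE (negPf na) mulr0.
have -> : Pi1 S = [set bar S i | i : 'I_n.+1 in [pred i : 'I_n.+1 | nbr_parity i]].
  apply/setP=> v; apply/idP/imsetP => [|[i]].
    rewrite !inE; case: imsetP => [[i _ ->] /=|]; last by rewrite andbF.
    rewrite andbT dotE => ci; exists i => //; rewrite inE.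
    by case: (nbr_parity i) ci.
  by rewrite !inE => ci ->; rewrite imset_f ?inE // dotE ci.
apply: (@card_in_imset _ _ (fun i : 'I_n.+1 => bar S i)) => i j.
rewrite !inE => ci cj eqb; apply/val_inj.
wlog ltij : i j ci cj eqb / (i < j)%N => [wl|].
  by case: (ltngtP i j) => // lt; [|symmetry]; apply: wl.
(* Index 0 has even parity, so [i.-1] exists; this coordinate is 1 in [bar S i] and 0 in
   [bar S j]. *)
have i_gt0 : (0 < i)%N by case: (val i) ci.
have lti : (i.-1 < i)%N by rewrite prednK.
have ltn : (i.-1 < n)%N by apply: leq_trans (ltn_trans lti ltij) _; rewrite -ltnS.
have := congr1 (fun v : 'cV_n.+1 => v (inord i.-1) 0) eqb.
rewrite !barE -1?ltnS // -(inj_eq val_inj) /= inordK ?ltnS ?(ltnW ltn) // prednK //.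
by rewrite eqxx !ltn_eqF // (ltn_trans lti).
Qed.

(** * Action of the moves on the bars *)

(** Only the bars [s] and [s.+1] have a nonzero coordinate [s]; the move takes the first to the
    second, and back because it is an involution. *)
Lemma flip_bar (s i : 'I_n.+1) : (s < n)%N ->
  flip_mx S s *m bar S i = bar S (tperm s (inord s.+1) i).
Proof.
move=> lts; have barS : flip_mx S s *m bar S s = bar S s.+1.
  by rewrite /= inord_val.
case: tpermP => [->|->|]; first by rewrite inordK.
  by rewrite inordK // -barS mulmxA flip_mxK mul1mx.
move=> /eqP nis /eqP niS.
rewrite flip_mulE barE -1?ltnS // -(inj_eq val_inj) /= ltn_eqF //.
rewrite -(inj_eq val_inj) eq_sym in nis.
rewrite -(inj_eq val_inj) /= inordK // eq_sym in niS.
by rewrite (negPf nis) (negPf niS) addr0 scale0r addr0.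
Qed.

Lemma perm_bar_in_flipping_group (s : 'S_n.+1) :
  exists2 g, g \in flipping_group S &
    (forall i : 'I_n.+1, val g *m bar S i = bar S (s i)) /\ val g *m top = top.
Proof.
pose acts (g : {'GL_n.+1['F_2]}) (t : 'S_n.+1) :=
  [forall i : 'I_n.+1, val g *m bar S i == bar S (t i)] && (val g *m top == top).
pose G := [set t | [exists g in flipping_group S, acts g t]].
have gG : group_set G.
  apply/group_setP; split=> [|t1 t2].
    rewrite inE; apply/exists_inP; exists 1%g; rewrite ?group1 // /acts.
    rewrite !mul1mx eqxx andbT; apply/forallP=> i.
    by rewrite mul1mx perm1.
  rewrite !inE => /exists_inP[g1 Wg1 /andP[/forallP act1 /eqP top1]].
  case/exists_inP=> g2 Wg2 /andP[/forallP act2 /eqP top2].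
  (* Permutations compose left to right while matrices act on columns from the left, hence the
     reversed order. *)
  apply/exists_inP; exists (g2 * g1)%g; rewrite ?groupM // /acts.
  rewrite FinRing.val_unitM -!mulmxA top1 top2 eqxx andbT; apply/forallP=> i.
  by rewrite -mulmxA (eqP (act1 i)) (eqP (act2 _)) permM.
have: s \in group gG.
  apply: gen_tperm_adjacent => i lti; rewrite inE; apply/exists_inP.
  exists (flip S i); first by rewrite mem_gen ?imset_f.
  apply/andP; split; first by apply/forallP=> j; rewrite /= flip_bar.
  have /negPf ni : i != ord_max by rewrite -(inj_eq val_inj) ltn_eqF.
  by rewrite /= flip_top ni scale0r addr0.
rewrite inE => /exists_inP[g Wg /andP[/forallP act /eqP topE]].
by exists g => //; split=> // i; apply/eqP.
Qed.

End Flipping.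

(** * Conjugating one flipping group into the other *)

(** An inclusion suffices: exchanging [S] and [S'] gives the opposite inequality between the orders
    of these finite groups. *)
Lemma conj_flipping_group (n : nat) (S S' : sgraph 'I_n.+1) :
  (0 < n)%N -> induced_path S -> induced_path S' -> #|Pi1 S| = #|Pi1 S'| ->
  exists x, (flipping_group S :^ x \subset flipping_group S')%g.
Proof.
move=> n_gt0 pathS pathS'; rewrite !card_Pi1 // => /card_eq_perm[s parS].
set top := char_vec (ord_max : 'I_n.+1).
have parE i : nbr_parity S' (s i) = nbr_parity S i := parS i.
have parVE i : nbr_parity S ((s^-1)%g i) = nbr_parity S' i by rewrite -parE permKV.
have eqk : \sum_(i < n.+1) (nbr_parity S i)%:R
    = \sum_(i < n.+1) (nbr_parity S' i)%:R :> 'F_2.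
  rewrite [RHS](reindex_inj (@perm_inj _ s)).
  by apply: eq_bigr => i _; rewrite parE.
have sumS : \sum_(i < n.+1) bar S' (s i)
    = (\sum_(i < n.+1) (nbr_parity S i)%:R) *: top.
  by rewrite eqk -sum_bar // [RHS](reindex_inj (@perm_inj _ s)).
have sumS' : \sum_(i < n.+1) bar S ((s^-1)%g i)
    = (\sum_(i < n.+1) (nbr_parity S' i)%:R) *: top.
  by rewrite -eqk -sum_bar // [RHS](reindex_inj (@perm_inj _ s^-1%g)).
have [M [Mbar Mtop]] := exists_mulmx_bar n_gt0 pathS sumS.
have [M' [M'bar M'top]] := exists_mulmx_bar n_gt0 pathS' sumS'.
have MM' : M *m M' = 1%:M.
  apply: (eq_mulmx_bar n_gt0 pathS') => [i|]; rewrite -mulmxA mul1mx.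
    by rewrite M'bar Mbar permKV.
  by rewrite M'top Mtop.
have M'M : M' *m M = 1%:M := mulmx1C MM'.
have unitM' : M' \is a GRing.unit by apply/unitrP; exists M.
(* As [g ^ x] is x^-1 g x, taking [M'] for [x] makes it M g M^-1. *)
pose x : {'GL_n.+1['F_2]} := FinRing.unit _ unitM'.
have flipJ a : exists2 g, g \in flipping_group S' & M *m flip_mx S a = val g *m M.
  have [lta|] := ltnP a n.
    (* [M] relabels the bars by [s], so the exchange of bars [a] and [a.+1] becomes the
       transposition conjugated by [s]. *)
    have [g Wg [gbar gtop]] :=
      perm_bar_in_flipping_group n_gt0 pathS' (tperm a (inord a.+1) ^ s)%g.
    exists g => //; apply: (eq_mulmx_bar n_gt0 pathS) => [i|].
      by rewrite -!mulmxA flip_bar // !Mbar gbar -permM conjgE !permM permK.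
    rewrite -!mulmxA flip_top -(inj_eq val_inj) /= ltn_eqF // scale0r addr0.
    by rewrite Mtop gtop.
  move=> gea; have {gea}-> : a = ord_max.
    by apply/val_inj/eqP; rewrite eqn_leq gea -ltnS ltn_ord.
  (* Both vectors have the same expression in parities, bars and [top], and [s] preserves
     parities. *)
  have MN : M *m nbr_vec S ord_max = nbr_vec S' ord_max.
    rewrite !nbr_vec_last // mulmxDr mulmx_sumr -scalemxAr Mtop eqk.
    congr (_ + _); rewrite [RHS](reindex_inj (@perm_inj _ s)).
    by apply: eq_bigr => i _; rewrite -scalemxAr Mbar parE.
  exists (flip S' ord_max); first by rewrite mem_gen ?imset_f.
  apply: (eq_mulmx_bar n_gt0 pathS) => [i|].
    rewrite -!mulmxA Mbar /= !flip_mulE mulmxDr -scalemxAr Mbar MN.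
    by rewrite !barE -1?ltnS // !eqxx parE.
  by rewrite -!mulmxA Mtop /= !flip_top mulmxDr -scalemxAr Mtop MN.
exists x; rewrite -genJ gen_subG; apply/subsetP=> _ /imsetP[_ /imsetP[a _ ->] ->].
have [g Wg flipg] := flipJ a; rewrite (_ : (_ ^ x)%g = g) //.
apply: (mulgI x); rewrite -conjgC; apply/val_inj.
rewrite !FinRing.val_unitM /=.
have: M' *m (M *m flip_mx S a) *m M' = M' *m (val g *m M) *m M' by rewrite flipg.
by rewrite !mulmxA M'M mul1mx -!mulmxA MM' mulmx1.
Qed.

Theorem theorem3p9 (n : nat) (hn : (2 <= n.+1)%N) (S S' : sgraph 'I_n.+1)
    (hS : satisfies_hypotheses S) (hS' : satisfies_hypotheses S')
    (hPi : #|Pi1 S| = #|Pi1 S'|) :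
  (flipping_group S \isog flipping_group S')%g.
Proof.
have [[_ pathS] [_ pathS']] := (hS, hS').
have [x sub] := conj_flipping_group hn pathS pathS' hPi.
have [y sub'] := conj_flipping_group hn pathS' pathS (esym hPi).
have le := subset_leq_card sub'; rewrite cardJg in le.
have eqJ : (flipping_group S :^ x)%g = flipping_group S'.
  by apply/eqP; rewrite eqEcard sub cardJg.
by rewrite -eqJ conj_isog.
Qed.
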